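(* Let $n$ be a positive integer and let $G$ be a group. Then there is a natural isomorphism $\theta[n]=\{\theta[n]_R:MC_n(R)[G]\to MC_n(R[G])\}_{R\in\mathfrak{R}}$ between the functors $R\mapsto MC_n(R)[G]$ and $R\mapsto MC_n(R[G])$ from $\mathfrak{R}$ to $\mathfrak{R}$.
   Context: All rings are associative with $1$; ring morphisms preserve $1$; $\mathfrak{R}$ is the category of rings. $R[G]$ is the group ring of $G$ over $R$. $M_m(R)$ is the ring of $m\times m$ matrices over $R$, and for a ring morphism $f:R\to S$, $M_m(f):M_m(R)\to M_m(S)$ applies $f$ entrywise. For $n\ge 1$ let $\eta^n_R:R\to M_n(R)$, $\eta^n_R(a)_{ij}=a\delta_{ij}$ (scalar matrices). Identify $M_n(M_{n^k}(R))$ with $M_{n^{k+1}}(R)$ via block matrices. For $n$ fixed, consider the direct system indexed by $k\in\mathbb{N}=\{0,1,2,\dots\}$ with objects $M_{n^k}(R)$ (so $M_{n^0}(R)=R$) and connecting maps $\eta^n_{M_{n^k}(R)}:M_{n^k}(R)\to M_{n^{k+1}}(R)$ (sending $A$ to the block diagonal matrix with $n$ diagonal blocks equal to $A$) and their composites. The $n$-matricial closure $MC_n(R)$ is the direct limit of this system in $\mathfrak{R}$, with canonical morphisms $i[R]^n_k:M_{n^k}(R)\to MC_n(R)$. For a ring morphism $f:R\to S$, $MC_n(f):MC_n(R)\to MC_n(S)$ is the unique ring morphism with $MC_n(f)\circ i[R]^n_k=i[S]^n_k\circ M_{n^k}(f)$ for all $k\in\mathbb{N}$. This makes $MC_n$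 a functor $\mathfrak{R}\to\mathfrak{R}$. *)

(* Defs.v *)
From HB Require Import structures.
From mathcomp Require Import all_boot all_order all_algebra.
From mathcomp Require Import finmap boolp.

Set Implicit Arguments.
Unset Strict Implicit.
Unset Printing Implicit Defensive.

Import GRing.Theory.

Local Open Scope fset_scope.
Local Open Scope quotient_scope.
Local Open Scope ring_scope.

(* Endofunctors of the category of associative unital rings. A [pzRingType] may
   be the zero ring, and equality of morphisms is taken pointwise; [fmap_ext]
   says that [fmap] respects it. *)

Record ringFunctor := RingFunctor {
  fobj :> pzRingType -> pzRingType;
  fmap : forall R S : pzRingType,
    {rmorphism R -> S} -> {rmorphism fobj R -> fobj S};
  fmap_ext : forall (R S : pzRingType) (f g : {rmorphism R -> S}),
    f =1 g -> fmap f =1 fmap g;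
  fmap_id : forall R : pzRingType,
    fmap (idfun : {rmorphism R -> R}) =1 idfun;
  fmap_comp : forall (R S T : pzRingType)
      (g : {rmorphism S -> T}) (f : {rmorphism R -> S}),
    fmap (g \o f : {rmorphism R -> T}) =1 fmap g \o fmap f }.

Section FunctorComp.
Variables H F : ringFunctor.

Definition comp_fmap (R S : pzRingType) (f : {rmorphism R -> S}) :
  {rmorphism H (F R) -> H (F S)} := fmap H (fmap F f).

Fact comp_fmap_ext (R S : pzRingType) (f g : {rmorphism R -> S}) :
  f =1 g -> comp_fmap f =1 comp_fmap g.
Proof. by move=> fg; apply/fmap_ext/fmap_ext. Qed.

Fact comp_fmap_id (R : pzRingType) :
  comp_fmap (idfun : {rmorphism R -> R}) =1 idfun.
Proof.
move=> x; rewrite -[RHS]fmap_id; apply: fmap_ext => y; exact: fmap_id.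
Qed.

Fact comp_fmap_comp (R S T : pzRingType)
    (g : {rmorphism S -> T}) (f : {rmorphism R -> S}) :
  comp_fmap (g \o f : {rmorphism R -> T}) =1 comp_fmap g \o comp_fmap f.
Proof.
by move=> x; rewrite -[RHS]fmap_comp; apply: fmap_ext => y; apply: fmap_comp.
Qed.

Definition comp_functor : ringFunctor :=
  RingFunctor comp_fmap_ext comp_fmap_id comp_fmap_comp.
End FunctorComp.

Record natTrans (F H : ringFunctor) := NatTrans {
  ncomp :> forall R : pzRingType, {rmorphism F R -> H R};
  naturality : forall (R S : pzRingType) (f : {rmorphism R -> S}),
    ncomp S \o fmap F f =1 fmap H f \o ncomp R }.

Definition ring_iso (R S : pzRingType) (f : {rmorphism R -> S}) : Prop :=
  exists g : {rmorphism S -> R}, cancel f g /\ cancel g f.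

Definition natIso (F H : ringFunctor) (theta : natTrans F H) : Prop :=
  forall R : pzRingType, ring_iso (theta R).

(* The element f stands for the formal sum of the f(x) x, x in G. *)
Definition groupring (R : pzRingType) (G : groupType) : Type :=
  {fsfun G -> R with 0}.

Section GroupRing.
Variables (R : pzRingType) (G : groupType).
Local Notation RG := (groupring R G).

HB.instance Definition _ := Choice.on RG.

Implicit Types f g h : {fsfun G -> R with 0}.

Definition gr_add f g : RG :=
  [fsfun x in finsupp f `|` finsupp g => f x + g x].

Definition gr_opp f : RG := [fsfun x in finsupp f => - f x].

Definition gr_one : RG := [fsfun x in [fset 1%g] => 1].

(* Convolution: the coefficient of z sums f x * g y over x * y = z. *)
Definition gr_mul f g : RG :=
  [fsfun z in [fset (x * y)%g | x in finsupp f, y in finsupp g] =>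
     \sum_(x <- finsupp f) f x * g (x^-1 * z)%g].

Lemma gr_addE f g x : gr_add f g x = f x + g x.
Proof.
rewrite fsfunE inE; case: ifP => // /negbT; rewrite negb_or.
by case/andP=> ??; rewrite !fsfun_dflt ?addr0.
Qed.

Lemma gr_oppE f x : gr_opp f x = - f x.
Proof. by rewrite fsfunE; case: finsuppP; rewrite ?oppr0. Qed.

Lemma gr_oneE x : gr_one x = (x == 1%g)%:R.
Proof. by rewrite fsfunE inE; case: eqP. Qed.

Lemma gr_mulE f g z :
  gr_mul f g z = \sum_(x <- finsupp f) f x * g (x^-1 * z)%g.
Proof.
rewrite fsfunE; case: ifPn => // zN; rewrite big_seq big1 // => x xf.
rewrite [g _]fsfun_dflt ?mulr0 //; apply: contra zN => yg.
by apply/imfset2P; exists x => //; exists (x^-1 * z)%g; rewrite ?mulgA ?mulgV ?mul1g.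
Qed.

Lemma gr_sum_incl f (A : {fset G}) (F : G -> R) : finsupp f `<=` A ->
  \sum_(x <- finsupp f) f x * F x = \sum_(x <- A) f x * F x.
Proof.
move=> fA; apply: big_fset_incl => // x _ xf.
by rewrite fsfun_dflt ?mul0r.
Qed.

Fact gr_addA : associative gr_add.
Proof. by move=> f g h; apply/fsfunP=> x; rewrite !gr_addE addrA. Qed.

Fact gr_addC : commutative gr_add.
Proof. by move=> f g; apply/fsfunP=> x; rewrite !gr_addE addrC. Qed.

Fact gr_add0 : left_id ([fsfun] : RG) gr_add.
Proof. by move=> f; apply/fsfunP=> x; rewrite gr_addE fsfunE add0r. Qed.

Fact gr_addN : left_inverse ([fsfun] : RG) gr_opp gr_add.
Proof. by move=> f; apply/fsfunP=> x; rewrite gr_addE gr_oppE fsfunE addNr. Qed.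

HB.instance Definition _ :=
  GRing.isZmodule.Build RG gr_addA gr_addC gr_add0 gr_addN.

Fact gr_mul1l : left_id gr_one gr_mul.
Proof.
move=> f; apply/fsfunP=> z; rewrite gr_mulE (@gr_sum_incl _ [fset 1%g]).
  by rewrite big_seq_fset1 gr_oneE eqxx mul1r invg1 mul1g.
by apply/fsubsetP=> x; rewrite mem_finsupp gr_oneE inE; case: (x == _); rewrite ?eqxx.
Qed.

Fact gr_mul1r : right_id gr_one gr_mul.
Proof.
move=> f; apply/fsfunP=> z.
rewrite gr_mulE (@gr_sum_incl _ (z |` finsupp f)) ?fsubsetUr //.
rewrite (big_fsetD1 z) ?fset1U1 //= gr_oneE mulVg eqxx mulr1.
rewrite big_seq big1 ?addr0 // => x; rewrite !inE => /andP[xz _].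
rewrite gr_oneE; case: eqP; rewrite ?mulr0 // => e.
by case/eqP: xz; rewrite -[x]mulg1 -e mulgA mulgV mul1g.
Qed.

Fact gr_mulDl : left_distributive gr_mul gr_add.
Proof.
move=> f g h; apply/fsfunP=> z; rewrite gr_addE !gr_mulE.
pose A := finsupp f `|` finsupp g `|` finsupp (gr_add f g).
rewrite !(@gr_sum_incl _ A) -?big_split /=.
- by apply: eq_bigr => x _; rewrite gr_addE mulrDl.
- by rewrite /A -fsetUA fsetUCA fsubsetUl.
- by rewrite /A -fsetUA fsubsetUl.
- by rewrite /A fsubsetUr.
Qed.

Fact gr_mulDr : right_distributive gr_mul gr_add.
Proof.
move=> f g h; apply/fsfunP=> z; rewrite gr_addE !gr_mulE -big_split /=.
by apply: eq_bigr => x _; rewrite gr_addE mulrDr.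
Qed.

Fact gr_mulA : associative gr_mul.
Proof.
move=> f g h; apply/fsfunP=> z; rewrite !gr_mulE.
pose A := [fset (x * y)%g | x in finsupp f, y in finsupp g].
rewrite (@gr_sum_incl (gr_mul f g) A); last first.
  apply/fsubsetP=> u; rewrite mem_finsupp /gr_mul fsfunE.
  by case: ifP => //; rewrite eqxx.
under [RHS]eq_bigr do rewrite gr_mulE big_distrl /=.
rewrite exchange_big /= big_seq [RHS]big_seq; apply: eq_bigr => x xf.
rewrite gr_mulE big_distrr /=.
have injx : injective (fun y => (x * y)%g) by move=> y1 y2 /mulgI.
transitivity (\sum_(u <- [fset (x * y)%g | y in finsupp g])
                f x * g (x^-1 * u)%g * h (u^-1 * z)%g).
  rewrite big_imfset /=; last by move=> y1 y2 _ _ /injx.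
  apply: eq_bigr => y _.
  by rewrite mulrA invgM !mulgA mulVg mul1g.
apply: big_fset_incl => [|u _ uN].
  apply/fsubsetP=> u /imfsetP[y /= yg ->].
  by apply/imfset2P; exists x => //; exists y.
rewrite [g _]fsfun_dflt ?mulr0 ?mul0r //; apply: contra uN => yg.
by apply/imfsetP; exists (x^-1 * u)%g; rewrite //= mulgA mulgV mul1g.
Qed.

HB.instance Definition _ := GRing.Zmodule_isPzRing.Build RG
  gr_mulA gr_mul1l gr_mul1r gr_mulDl gr_mulDr.

End GroupRing.

Section GroupRingFunctor.
Variable G : groupType.

Section Map.
Variables (R S : pzRingType) (f : {rmorphism R -> S}).

Definition gr_map (a : groupring R G) : groupring S G :=
  [fsfun x in finsupp a => f (a x)].

Lemma gr_mapE a x : gr_map a x = f (a x).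
Proof. by rewrite fsfunE; case: finsuppP; rewrite ?rmorph0. Qed.

Fact gr_map_is_zmod_morphism : zmod_morphism gr_map.
Proof.
move=> a b; apply/fsfunP=> x.
by rewrite gr_mapE !gr_addE !gr_oppE !gr_mapE rmorphB.
Qed.

Fact gr_map_is_monoid_morphism : monoid_morphism gr_map.
Proof.
split=> [|a b]; apply/fsfunP=> x.
  by rewrite gr_mapE !gr_oneE rmorph_nat.
rewrite gr_mapE !gr_mulE rmorph_sum (@gr_sum_incl _ _ _ (finsupp a)).
  by apply: eq_bigr => y _; rewrite !gr_mapE rmorphM.
apply/fsubsetP=> y; rewrite !mem_finsupp gr_mapE.
by apply: contra => /eqP->; rewrite rmorph0.
Qed.

HB.instance Definition _ := GRing.isZmodMorphism.Build _ _ gr_map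
  gr_map_is_zmod_morphism.
HB.instance Definition _ := GRing.isMonoidMorphism.Build _ _ gr_map
  gr_map_is_monoid_morphism.
End Map.

Fact gr_map_ext (R S : pzRingType) (f g : {rmorphism R -> S}) :
  f =1 g -> gr_map f =1 gr_map g.
Proof. by move=> fg a; apply/fsfunP=> x; rewrite !gr_mapE fg. Qed.

Fact gr_map_id (R : pzRingType) :
  gr_map (idfun : {rmorphism R -> R}) =1 idfun.
Proof. by move=> a; apply/fsfunP=> x; rewrite gr_mapE. Qed.

Fact gr_map_comp (R S T : pzRingType)
    (g : {rmorphism S -> T}) (f : {rmorphism R -> S}) :
  gr_map (g \o f : {rmorphism R -> T}) =1 gr_map g \o gr_map f.
Proof. by move=> a; apply/fsfunP=> x; rewrite /= !gr_mapE. Qed.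

Definition groupring_functor : ringFunctor :=
  @RingFunctor (fun R => groupring R G) (fun R S f => gr_map f)
    gr_map_ext gr_map_id gr_map_comp.
End GroupRingFunctor.

Record dirsys := DirSys {
  dob :> nat -> pzRingType;
  dtr : forall k, {rmorphism dob k -> dob k.+1} }.

Section Push.
Variable D : dirsys.

Fixpoint dtr_iter (k d : nat) : D k -> D (d + k)%N :=
  if d is d'.+1 then fun a => dtr D (d' + k) (dtr_iter d' a) else id.

(* The composite of the connecting maps from stage k to stage m; [ecast] only
   transports along the equality m - k + k = m. *)
Definition push (k m : nat) (km : (k <= m)%N) (a : D k) : D m :=
  ecast i (D i) (subnK km) (dtr_iter (m - k) a).

Fact dtr_iter_zmod k d : zmod_morphism (@dtr_iter k d).
Proof. by elim: d => [|d IHd] a b //=; rewrite IHd rmorphB. Qed.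

Fact dtr_iter_monoid k d : monoid_morphism (@dtr_iter k d).
Proof.
by elim: d => [|d [IH1 IHM]]; split=> //= [|a b]; rewrite ?IH1 ?rmorph1 ?IHM ?rmorphM.
Qed.

Fact push_zmod k m (km : (k <= m)%N) : zmod_morphism (push km).
Proof.
rewrite /push; move: (m - k)%N (subnK km) => d e.
by case: m / e {km} => a b; apply: dtr_iter_zmod.
Qed.

Fact push_monoid k m (km : (k <= m)%N) : monoid_morphism (push km).
Proof.
rewrite /push; move: (m - k)%N (subnK km) => d e.
by case: m / e {km}; apply: dtr_iter_monoid.
Qed.

HB.instance Definition _ k m km := GRing.isZmodMorphism.Build _ _
  (@push k m km) (push_zmod km).
HB.instance Definition _ k m km := GRing.isMonoidMorphism.Build _ _
  (@push k m km) (push_monoid km).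

Local Notation stage k a := (existT (fun i => D i : Type) k a).

Let step (x : {k : nat & D k}) : {k : nat & D k} :=
  stage (tag x).+1 (dtr D (tag x) (tagged x)).

Lemma push_step k m (km : (k <= m)%N) (a : D k) :
  stage m (push km a) = iter (m - k) step (stage k a).
Proof.
rewrite /push; move: (m - k)%N (subnK km) => d e.
by case: m / e {km}; elim: d => //= d <-.
Qed.

Lemma push_inj_tag m (a b : D m) : stage m a = stage m b -> a = b.
Proof. by move/eqP; rewrite -tag_eqE /tag_eq /= eqxx tagged_asE => /eqP. Qed.

Lemma push_id k (kk : (k <= k)%N) a : push kk a = a.
Proof. by apply: push_inj_tag; rewrite push_step subnn. Qed.

Lemma push_trans k l m (kl : (k <= l)%N) (lm : (l <= m)%N) (km : (k <= m)%N) a :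
  push lm (push kl a) = push km a.
Proof.
by apply: push_inj_tag; rewrite !push_step -iterD addnBA // subnK.
Qed.

Lemma push_dtr k (kk : (k <= k.+1)%N) a : push kk a = dtr D k a.
Proof. by apply: push_inj_tag; rewrite push_step subSn // subnn. Qed.

End Push.

Section DirectLimit.
Variable D : dirsys.
Implicit Types x y z : {k : nat & D k}.

Definition dl_rel x y : bool :=
  `[< exists m (xm : (tag x <= m)%N) (ym : (tag y <= m)%N),
        push xm (tagged x) = push ym (tagged y) >].

Fact dl_relxx : reflexive dl_rel.
Proof. by move=> x; apply/asboolP; exists (tag x), (leqnn _), (leqnn _). Qed.

Fact dl_rel_sym : symmetric dl_rel.
Proof.
by move=> x y; apply/asboolP/asboolP => -[m [xm [ym e]]]; exists m, ym, xm.
Qed.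

Fact dl_rel_trans : transitive dl_rel.
Proof.
move=> y x z /asboolP[m [xm [ym e1]]] /asboolP[p [yp [zp e2]]]; apply/asboolP.
have xq := leq_trans xm (leq_addr p m); have yq := leq_trans ym (leq_addr p m).
have zq := leq_trans zp (leq_addl m p); exists (m + p)%N, xq, zq.
rewrite -(push_trans xm (leq_addr p m)) e1 (push_trans _ _ yq).
by rewrite -(push_trans zp (leq_addl m p)) -e2 (push_trans _ _ yq).
Qed.

Canonical dl_equiv := EquivRel dl_rel dl_relxx dl_rel_sym dl_rel_trans.

Definition dirlim : Type := {eq_quot dl_equiv}.

HB.instance Definition _ := Choice.on dirlim.

Definition dl_in (k : nat) (a : D k) : dirlim :=
  \pi_({eq_quot dl_equiv}) (existT (fun i => D i : Type) k a).

Lemma dl_in_eqP k l (a : D k) (b : D l) :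
  dl_in a = dl_in b <->
  exists m (km : (k <= m)%N) (lm : (l <= m)%N), push km a = push lm b.
Proof.
split=> [/eqquotP/asboolP //|e].
by apply/eqquotP/asboolP.
Qed.

Lemma dl_in_push k m (km : (k <= m)%N) (a : D k) : dl_in (push km a) = dl_in a.
Proof.
apply/dl_in_eqP; exists m, (leqnn m), km; exact: push_id.
Qed.

Lemma dl_in_dtr k (a : D k) : dl_in (dtr D k a) = dl_in a.
Proof. by rewrite -(push_dtr (leqnSn k)) dl_in_push. Qed.

Lemma dl_inP (u : dirlim) : exists k (a : D k), u = dl_in a.
Proof. by rewrite -(reprK u); case: (repr u) => k a; exists k, a. Qed.

Lemma dl_inP2 (u v : dirlim) :
  exists k (a b : D k), u = dl_in a /\ v = dl_in b.
Proof.
have [[k [a ->]] [l [b ->]]] := (dl_inP u, dl_inP v).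
exists (k + l)%N, (push (leq_addr l k) a), (push (leq_addl k l) b).
by rewrite !dl_in_push.
Qed.

Lemma dl_inP3 (u v w : dirlim) :
  exists k (a b c : D k), [/\ u = dl_in a, v = dl_in b & w = dl_in c].
Proof.
have [[k [a [b [-> ->]]]] [l [c ->]]] := (dl_inP2 u v, dl_inP w).
exists (k + l)%N, (push (leq_addr l k) a), (push (leq_addr l k) b),
  (push (leq_addl k l) c).
by rewrite !dl_in_push.
Qed.

(* Representatives are pushed to a common stage, where [op] is applied. *)
Definition dl_op2 (op : forall k, D k -> D k -> D k) (u v : dirlim) : dirlim :=
  let x := repr u in let y := repr v in
  dl_in (op (tag x + tag y)%N (push (leq_addr (tag y) (tag x)) (tagged x))
                              (push (leq_addl (tag x) (tag y)) (tagged y))).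

Definition dl_add := dl_op2 (fun k => +%R).
Definition dl_mul := dl_op2 (fun k => *%R).
Definition dl_opp (u : dirlim) : dirlim := dl_in (- tagged (repr u)).
Definition dl_zero : dirlim := dl_in (0 : D 0).
Definition dl_one : dirlim := dl_in (1 : D 0).

Lemma dl_repr k (a : D k) :
  exists m (xm : (tag (repr (dl_in a)) <= m)%N) (km : (k <= m)%N),
    push xm (tagged (repr (dl_in a))) = push km a.
Proof.
apply/dl_in_eqP; rewrite -[RHS]reprK.
by case: (repr (dl_in a)).
Qed.

Lemma dl_op2E (op : forall k, D k -> D k -> D k) :
    (forall k m (km : (k <= m)%N) a b,
       push km (op k a b) = op m (push km a) (push km b)) ->
  forall k (a b : D k), dl_op2 op (dl_in a) (dl_in b) = dl_in (op k a b).
Proof.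
move=> opP k a b; rewrite /dl_op2.
have [m [xm [km ea]]] := dl_repr a; have [p [yp [kp eb]]] := dl_repr b.
set x := repr (dl_in a) in xm ea *; set y := repr (dl_in b) in yp eb *.
pose q := ((m + p) + (tag x + tag y))%N.
have mq : (m <= q)%N by rewrite /q -addnA leq_addr.
have pq : (p <= q)%N by rewrite /q addnAC leq_addl.
have sq : (tag x + tag y <= q)%N by rewrite leq_addl.
apply/dl_in_eqP; exists q, sq, (leq_trans km mq); rewrite !opP; congr (op q _ _).
  rewrite (push_trans _ _ (leq_trans xm mq)) -(push_trans xm mq) ea.
  exact: push_trans.
rewrite (push_trans _ _ (leq_trans yp pq)) -(push_trans yp pq) eb.
exact: push_trans.
Qed.

Lemma dl_addE k (a b : D k) : dl_add (dl_in a) (dl_in b) = dl_in (a + b).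
Proof. by apply: dl_op2E => *; rewrite rmorphD. Qed.

Lemma dl_mulE k (a b : D k) : dl_mul (dl_in a) (dl_in b) = dl_in (a * b).
Proof. by apply: dl_op2E => *; rewrite rmorphM. Qed.

Lemma dl_oppE k (a : D k) : dl_opp (dl_in a) = dl_in (- a).
Proof.
have [m [xm [km e]]] := dl_repr a.
by apply/dl_in_eqP; exists m, xm, km; rewrite !rmorphN /= e.
Qed.

Lemma dl_zeroE k : dl_zero = dl_in (0 : D k).
Proof. by rewrite /dl_zero -(dl_in_push (leq0n k)) rmorph0. Qed.

Lemma dl_oneE k : dl_one = dl_in (1 : D k).
Proof. by rewrite /dl_one -(dl_in_push (leq0n k)) rmorph1. Qed.

Fact dl_addA : associative dl_add.
Proof.
by move=> u v w; have [k [a [b [c [-> -> ->]]]]] := dl_inP3 u v w; rewrite !dl_addE addrA.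
Qed.

Fact dl_addC : commutative dl_add.
Proof. by move=> u v; have [k [a [b [-> ->]]]] := dl_inP2 u v; rewrite !dl_addE addrC. Qed.

Fact dl_add0 : left_id dl_zero dl_add.
Proof. by move=> u; have [k [a ->]] := dl_inP u; rewrite (dl_zeroE k) dl_addE add0r. Qed.

Fact dl_addN : left_inverse dl_zero dl_opp dl_add.
Proof.
by move=> u; have [k [a ->]] := dl_inP u; rewrite dl_oppE dl_addE addNr (dl_zeroE k).
Qed.

HB.instance Definition _ :=
  GRing.isZmodule.Build dirlim dl_addA dl_addC dl_add0 dl_addN.

Fact dl_mulA : associative dl_mul.
Proof.
by move=> u v w; have [k [a [b [c [-> -> ->]]]]] := dl_inP3 u v w; rewrite !dl_mulE mulrA.
Qed.

Fact dl_mul1l : left_id dl_one dl_mul.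
Proof. by move=> u; have [k [a ->]] := dl_inP u; rewrite (dl_oneE k) dl_mulE mul1r. Qed.

Fact dl_mul1r : right_id dl_one dl_mul.
Proof. by move=> u; have [k [a ->]] := dl_inP u; rewrite (dl_oneE k) dl_mulE mulr1. Qed.

Fact dl_mulDl : left_distributive dl_mul dl_add.
Proof.
move=> u v w; have [k [a [b [c [-> -> ->]]]]] := dl_inP3 u v w.
by rewrite !(dl_mulE, dl_addE) mulrDl.
Qed.

Fact dl_mulDr : right_distributive dl_mul dl_add.
Proof.
move=> u v w; have [k [a [b [c [-> -> ->]]]]] := dl_inP3 u v w.
by rewrite !(dl_mulE, dl_addE) mulrDr.
Qed.

HB.instance Definition _ := GRing.Zmodule_isPzRing.Build dirlim
  dl_mulA dl_mul1l dl_mul1r dl_mulDl dl_mulDr.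

Fact dl_in_zmod k : zmod_morphism (@dl_in k).
Proof. by move=> a b; rewrite -dl_addE -dl_oppE. Qed.

Fact dl_in_monoid k : monoid_morphism (@dl_in k).
Proof. by split=> [|a b]; [rewrite -dl_oneE | rewrite -dl_mulE]. Qed.

HB.instance Definition _ k := GRing.isZmodMorphism.Build (D k) dirlim
  (@dl_in k) (@dl_in_zmod k).
HB.instance Definition _ k := GRing.isMonoidMorphism.Build (D k) dirlim
  (@dl_in k) (@dl_in_monoid k).

End DirectLimit.

Record cocone (D : dirsys) (S : pzRingType) := Cocone {
  leg :> forall k, {rmorphism D k -> S};
  legE : forall k (a : D k), leg k.+1 (dtr D k a) = leg k a }.

Section Desc.
Variables (D : dirsys) (S : pzRingType) (c : cocone D S).

Definition dl_desc (u : dirlim D) : S := c _ (tagged (repr u)).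

Lemma leg_push k m (km : (k <= m)%N) (a : D k) : c m (push km a) = c k a.
Proof.
rewrite /push; move: (m - k)%N (subnK km) => d e; case: m / e {km}.
by elim: d => //= d <-; rewrite legE.
Qed.

Lemma dl_descE k (a : D k) : dl_desc (dl_in a) = c k a.
Proof.
have [m [xm [km e]]] := dl_repr a.
by rewrite /dl_desc -(leg_push xm) e leg_push.
Qed.

Lemma dl_desc_uniq (h : dirlim D -> S) :
  (forall k (a : D k), h (dl_in a) = c k a) -> h =1 dl_desc.
Proof. by move=> hE u; have [k [a ->]] := dl_inP u; rewrite hE dl_descE. Qed.

Fact dl_desc_zmod : zmod_morphism dl_desc.
Proof.
move=> u v; have [k [a [b [-> ->]]]] := dl_inP2 u v.
by rewrite -rmorphB !dl_descE rmorphB.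
Qed.

Fact dl_desc_monoid : monoid_morphism dl_desc.
Proof.
split=> [|u v]; first by rewrite -(rmorph1 (@dl_in D 0)) dl_descE rmorph1.
have [k [a [b [-> ->]]]] := dl_inP2 u v.
by rewrite -rmorphM !dl_descE rmorphM.
Qed.

HB.instance Definition _ := GRing.isZmodMorphism.Build _ _ dl_desc dl_desc_zmod.
HB.instance Definition _ :=
  GRing.isMonoidMorphism.Build _ _ dl_desc dl_desc_monoid.
End Desc.

(* The identification of M_n(M_m(R)) with M_N(R), N = n * m, by block matrices;
   [e] records that the block sizes add up to N. *)
Section Blocks.
Variables (R : pzRingType) (n m N : nat) (e : (\sum_(i < n) m)%N = N).

Definition unblock (B : 'M['M[R]_m]_n) : 'M[R]_N :=
  castmx (e, e) (\mxblock_(i < n, j < n) B i j).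

Fact unblock_zmod : zmod_morphism unblock.
Proof.
move=> A B; rewrite /unblock; case: N / e; rewrite !castmx_id.
by rewrite -mxblockB; apply: eq_mxblock => i j; rewrite !mxE.
Qed.

Fact unblock_monoid : monoid_morphism unblock.
Proof.
rewrite /unblock; case: N / e; split=> [|A B]; rewrite !castmx_id.
  rewrite -[RHS]mxdiagZ; apply: eq_mxblock => i j; rewrite mxE conform_mx_id.
  by rewrite mulrb; case: eqP => // <-.
rewrite [RHS]mul_mxblock; apply: eq_mxblock => i j.
by rewrite mxE.
Qed.

HB.instance Definition _ := GRing.isZmodMorphism.Build 'M['M[R]_m]_n 'M[R]_N
  unblock unblock_zmod.
HB.instance Definition _ := GRing.isMonoidMorphism.Build 'M['M[R]_m]_n 'M[R]_N
  unblock unblock_monoid.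
End Blocks.

Fact MC_size n k : (\sum_(i < n) n ^ k)%N = (n ^ k.+1)%N.
Proof. by rewrite sum_nat_const card_ord expnS. Qed.

Section MatricialClosure.
Variable n : nat.

(* [scalar_mx] over the ring 'M[R]_(n ^ k) is the scalar matrix with diagonal
   entries A, hence the block diagonal matrix with n blocks A. *)
Definition MC_tr (R : pzRingType) (k : nat) :
    {rmorphism 'M[R]_(n ^ k) -> 'M[R]_(n ^ k.+1)} :=
  @unblock R n (n ^ k) (n ^ k.+1) (MC_size n k) \o
    (@scalar_mx 'M[R]_(n ^ k) n).

(* Stage 0 is 'M[R]_(n ^ 0), the ring of 1 x 1 matrices, identified with R. *)
Definition MC_sys (R : pzRingType) : dirsys :=
  @DirSys (fun k => 'M[R]_(n ^ k)) (MC_tr R).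

Definition MC (R : pzRingType) : pzRingType := dirlim (MC_sys R).

Definition MC_in (R : pzRingType) (k : nat) :
  {rmorphism 'M[R]_(n ^ k) -> MC R} :=
  (@dl_in (MC_sys R) k : {rmorphism MC_sys R k -> dirlim (MC_sys R)}).

Section Map.
Variables (R S : pzRingType) (f : {rmorphism R -> S}).

Fact MC_trN k (A : 'M[R]_(n ^ k)) :
  map_mx f (MC_tr R k A) = MC_tr S k (map_mx f A).
Proof.
rewrite /MC_tr /= /unblock map_castmx; congr castmx.
apply/matrixP=> i j; rewrite !mxE.
by rewrite !mulrb; case: eqP; rewrite ?mxE ?rmorph0.
Qed.

Definition MC_cocone_leg k : {rmorphism 'M[R]_(n ^ k) -> MC S} :=
  MC_in S k \o (map_mx f : 'M[R]_(n ^ k) -> 'M[S]_(n ^ k)).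

Fact MC_cocone_legE k (A : 'M[R]_(n ^ k)) :
  MC_cocone_leg k.+1 (MC_tr R k A) = MC_cocone_leg k A.
Proof. by rewrite /= MC_trN; apply: (@dl_in_dtr (MC_sys S)). Qed.

Definition MC_cocone : cocone (MC_sys R) (MC S) :=
  @Cocone (MC_sys R) (MC S) MC_cocone_leg MC_cocone_legE.

Definition MC_map : {rmorphism MC R -> MC S} := dl_desc MC_cocone.

Lemma MC_mapE k (A : 'M[R]_(n ^ k)) :
  MC_map (MC_in R k A) = MC_in S k (map_mx f A).
Proof. exact: (dl_descE MC_cocone). Qed.

Lemma MC_map_uniq (h : {rmorphism MC R -> MC S}) :
  (forall k (A : 'M[R]_(n ^ k)), h (MC_in R k A) = MC_in S k (map_mx f A)) ->
  h =1 MC_map.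
Proof. exact: (@dl_desc_uniq _ _ MC_cocone h). Qed.
End Map.

Lemma MC_inP (R : pzRingType) (u : MC R) :
  exists k (A : 'M[R]_(n ^ k)), u = MC_in R k A.
Proof. exact: (@dl_inP (MC_sys R)). Qed.

Fact MC_map_ext (R S : pzRingType) (f g : {rmorphism R -> S}) :
  f =1 g -> MC_map f =1 MC_map g.
Proof.
move=> fg u; have [k [A ->]] := MC_inP u; rewrite !MC_mapE.
by congr (MC_in S k _); apply/matrixP=> i j; rewrite !mxE fg.
Qed.

Fact MC_map_id (R : pzRingType) :
  MC_map (idfun : {rmorphism R -> R}) =1 idfun.
Proof.
move=> u; have [k [A ->]] := MC_inP u; rewrite MC_mapE.
by congr (MC_in R k _); apply/matrixP=> i j; rewrite !mxE.
Qed.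

Fact MC_map_comp (R S T : pzRingType)
    (g : {rmorphism S -> T}) (f : {rmorphism R -> S}) :
  MC_map (g \o f : {rmorphism R -> T}) =1 MC_map g \o MC_map f.
Proof.
move=> u; have [k [A ->]] := MC_inP u; rewrite [RHS]/comp !MC_mapE.
by congr (MC_in T k _); apply/matrixP=> i j; rewrite !mxE.
Qed.

Definition MC_functor : ringFunctor :=
  RingFunctor MC_map_ext MC_map_id MC_map_comp.
End MatricialClosure.

(* Main.v *)
Require Import Defs.
From HB Require Import structures.
From mathcomp Require Import all_boot all_algebra.
From mathcomp Require Import finmap boolp.

(* Collecting coefficients is a ring morphism from M_N(R[G]) to M_N(R)[G]; for
   N = n^k these maps commute with the connecting morphisms, hence induce a
   natural morphism MC_n(R[G]) -> MC_n(R)[G], whose inverse is theta. It is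
   surjective because MC_n(R)[G] is generated additively by the terms u x with
   u in MC_n(R) and x in G, each coming from a single stage. It is injective
   because a matrix over R[G] has finitely many nonzero coefficients: if they
   all die in the limit, they die at a common stage. *)

Set Implicit Arguments.
Unset Strict Implicit.
Unset Printing Implicit Defensive.

Import GRing.Theory.

Local Open Scope fset_scope.
Local Open Scope ring_scope.

(** A sigma type rather than an existential, so that one inverse can be selected for every ring at
    once when the natural transformation is assembled. The inverse is chosen pointwise with [cid];
    it respects the ring operations because [f] does and is injective. *)
Lemma bij_ring_iso (R S : pzRingType) (f : {rmorphism R -> S}) :
    injective f -> (forall b, exists a, f a = b) ->
  {g : {rmorphism S -> R} | cancel f g /\ cancel g f}.
Proof.
move=> f_inj f_surj; pose g b := projT1 (cid (f_surj b)).
have gK : cancel g f by move=> b; apply: projT2 (cid (f_surj b)).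
have fK : cancel f g by move=> a; apply: f_inj; rewrite gK.
have gZ : zmod_morphism g by move=> a b; apply: f_inj; rewrite rmorphB !gK.
have gM : monoid_morphism g.
  by split=> [|a b]; apply: f_inj; rewrite ?rmorph1 ?rmorphM !gK.
pose gA := GRing.isZmodMorphism.Build _ _ g gZ.
pose gMM := GRing.isMonoidMorphism.Build _ _ g gM.
pose gR : {rmorphism S -> R} := HB.pack g gA gMM.
by exists gR.
Qed.

Section Push.
Variables D E : dirsys.

(** The maps [h k] are bare functions because the intended instance, taking the coefficient at a
    fixed group element, is not multiplicative. *)
Lemma push_natural (h : forall k, D k -> E k) :
    (forall k a, h k.+1 (dtr D k a) = dtr E k (h k a)) ->
  forall k m (km : (k <= m)%N) a, h m (push km a) = push km (h k a).
Proof.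
move=> hE k m km a; rewrite /push; move: (m - k)%N (subnK km) => d e.
by case: m / e {km}; elim: d => //= d IHd; rewrite hE IHd.
Qed.

Lemma dl_in_eq0 k (a : D k) :
  dl_in a = 0 -> exists m (km : (k <= m)%N), push km a = 0.
Proof.
rewrite -(rmorph0 (@dl_in D k)) => /dl_in_eqP[m [km [km' e]]].
by exists m, km; rewrite e rmorph0.
Qed.

(** Each term vanishes at some stage of its own, and zero stays zero under [push]; as [s] is finite,
    adding up these stages gives a common one. *)
Lemma dl_in_eq0_seq (I : eqType) (s : seq I) k (a : I -> D k) :
    (forall i, dl_in (a i) = 0) ->
  exists m (km : (k <= m)%N), {in s, forall i, push km (a i) = 0}.
Proof.
move=> a0; elim: s => [|i s [m [km IHs]]]; first by exists k, (leqnn k).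
have [p [kp ai0]] := dl_in_eq0 (a0 i).
exists (m + p)%N, (leq_trans km (leq_addr p m)) => j.
rewrite inE => /predU1P[->|js].
  by rewrite -(push_trans kp (leq_addl m p)) ai0 rmorph0.
by rewrite -(push_trans km (leq_addr p m)) IHs ?rmorph0.
Qed.
End Push.

Section GroupRingTheory.
Variables (R : pzRingType) (G : groupType).

Lemma gr_sumE (I : Type) (r : seq I) (P : pred I) (F : I -> groupring R G) x :
  (\sum_(i <- r | P i) F i) x = \sum_(i <- r | P i) F i x.
Proof.
by apply: (big_morph (fun f : groupring R G => f x)) => [f g|];
  rewrite ?gr_addE ?fsfunE.
Qed.

Definition gr_single (x : G) (a : R) : groupring R G :=
  [fsfun y in [fset x] => a].

Lemma gr_singleE x a y : gr_single x a y = if y == x then a else 0.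
Proof. by rewrite fsfunE inE. Qed.

Lemma gr_sum_single (a : groupring R G) :
  a = \sum_(x <- finsupp a) gr_single x (a x).
Proof.
apply/fsfunP=> y; rewrite gr_sumE; under eq_bigr do rewrite gr_singleE.
case: (finsuppP a y) => [yN|ya].
  rewrite big_seq big1 // => x xa; case: eqP => // yx.
  by rewrite -yx (negPf yN) in xa.
rewrite (big_fsetD1 y) //= eqxx big_seq big1 ?addr0 // => x.
by rewrite !inE => /andP[xy _]; rewrite eq_sym (negPf xy).
Qed.

Section Coefficients.
Variable N : nat.
Implicit Types A B : 'M[groupring R G]_N.

Definition mxcoef (x : G) A : 'M[R]_N :=
  map_mx (fun f : groupring R G => f x) A.

(** This finite set bounds all sums over group elements attached to [A], and it leaves only finitely
    many coefficients to kill in the injectivity proof. *)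
Definition mxsupp A : {fset G} :=
  \bigcup_(ij <- enum {: 'I_N * 'I_N}) finsupp (A ij.1 ij.2).

Lemma finsupp_sub_mxsupp A i j : finsupp (A i j) `<=` mxsupp A.
Proof. by apply: (@bigfcup_sup _ _ _ (i, j)) => //; rewrite mem_enum. Qed.

Lemma mxcoef_dflt A x : x \notin mxsupp A -> mxcoef x A = 0.
Proof.
move=> xA; apply/matrixP=> i j; rewrite !mxE fsfun_dflt //.
by apply: contra xA; apply/fsubsetP/finsupp_sub_mxsupp.
Qed.

Lemma mxcoef_inj A B : (forall x, mxcoef x A = mxcoef x B) -> A = B.
Proof.
move=> AB; apply/matrixP=> i j; apply/fsfunP=> x.
by have /matrixP/(_ i j) := AB x; rewrite !mxE.
Qed.

Definition mxgr A : groupring 'M[R]_N G := [fsfun x in mxsupp A => mxcoef x A].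

Lemma mxgrE A x : mxgr A x = mxcoef x A.
Proof. by rewrite fsfunE; case: ifPn => // /mxcoef_dflt->. Qed.

Fact mxgr_zmod : zmod_morphism mxgr.
Proof.
move=> A B; apply/fsfunP=> x; rewrite gr_addE gr_oppE !mxgrE.
by apply/matrixP=> i j; rewrite !mxE gr_addE gr_oppE.
Qed.

Fact mxgr_monoid : monoid_morphism mxgr.
Proof.
split=> [|A B]; apply/fsfunP=> x; rewrite mxgrE.
  rewrite gr_oneE; apply/matrixP=> i j; rewrite !mxE.
  have [<-|/negPf ij] := eqVneq i j.
    by rewrite [LHS]gr_oneE; case: (x == 1%g); rewrite !mxE ?eqxx.
  by rewrite fsfunE; case: (x == 1%g); rewrite !mxE ?ij.
(* The support of [mxgr A] and those of the entries of [A] are all enlarged to [mxsupp A]; with an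
   index set independent of the entry, the sum over the group and the sum of the matrix product can
   be exchanged. *)
rewrite gr_mulE (@gr_sum_incl _ _ _ (mxsupp A)); last first.
  apply/fsubsetP=> y; rewrite mem_finsupp mxgrE.
  by apply: contraR => /mxcoef_dflt->.
apply/matrixP=> i j; rewrite !mxE gr_sumE summxE.
under [RHS]eq_bigr do rewrite !mxgrE mxE.
rewrite exchange_big /=; apply: eq_bigr => l _.
rewrite gr_mulE (gr_sum_incl _ (finsupp_sub_mxsupp A i l)).
by apply: eq_bigr => y _; rewrite !mxE.
Qed.

HB.instance Definition _ := GRing.isZmodMorphism.Build _ _ mxgr mxgr_zmod.
HB.instance Definition _ := GRing.isMonoidMorphism.Build _ _ mxgr mxgr_monoid.
End Coefficients.
End GroupRingTheory.

Section Comparison.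
Variables (n : nat) (G : groupType).

(** The connecting map only copies [A] along the diagonal and fills in zeros, so any entrywise map
    preserving 0 commutes with it. [MC_trN] does not apply, since it asks for a ring morphism. *)
Lemma mxcoef_MC_tr (R : pzRingType) x k (A : 'M[groupring R G]_(n ^ k)) :
  mxcoef x (MC_tr n _ k A) = MC_tr n R k (mxcoef x A).
Proof.
rewrite /MC_tr /= /unblock /mxcoef map_castmx; congr castmx.
apply/matrixP=> i j; rewrite !mxE.
by rewrite !mulrb; case: eqP; rewrite ?mxE ?fsfunE.
Qed.

Lemma mxcoef_push (R : pzRingType) x k m (km : (k <= m)%N)
    (A : 'M[groupring R G]_(n ^ k)) :
  mxcoef x (push (D := MC_sys n (groupring R G)) km A) =
  push (D := MC_sys n R) km (mxcoef x A).
Proof.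
apply: (push_natural (D := MC_sys n (groupring R G)) (E := MC_sys n R)
  (h := fun k => @mxcoef R G (n ^ k) x)).
exact: mxcoef_MC_tr.
Qed.

Section Ring.
Variable R : pzRingType.

Definition MC_gr_leg k :
    {rmorphism 'M[groupring R G]_(n ^ k) -> groupring (MC n R) G} :=
  gr_map (MC_in n R k) \o @mxgr R G (n ^ k).

Lemma MC_gr_legE k A x : MC_gr_leg k A x = MC_in n R k (mxcoef x A).
Proof. by rewrite /= gr_mapE mxgrE. Qed.

Fact MC_gr_leg_tr k A :
  MC_gr_leg k.+1 (MC_tr n (groupring R G) k A) = MC_gr_leg k A.
Proof.
apply/fsfunP=> x; rewrite !MC_gr_legE mxcoef_MC_tr.
exact: (@dl_in_dtr (MC_sys n R)).
Qed.

Definition MC_gr_cocone :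
    cocone (MC_sys n (groupring R G)) (groupring (MC n R) G) :=
  @Cocone (MC_sys n (groupring R G)) _ MC_gr_leg MC_gr_leg_tr.

Definition MC_gr : {rmorphism MC n (groupring R G) -> groupring (MC n R) G} :=
  dl_desc MC_gr_cocone.

Lemma MC_grE k A x :
  MC_gr (MC_in n (groupring R G) k A) x = MC_in n R k (mxcoef x A).
Proof.
rewrite -MC_gr_legE; congr (fun_of_fsfun _ x); exact: (dl_descE MC_gr_cocone).
Qed.

Lemma MC_gr_inj : injective MC_gr.
Proof.
apply: raddf_inj => u; have [k [A ->]] := MC_inP u => A0.
have coef0 x : dl_in (D := MC_sys n R) (mxcoef x A : MC_sys n R k) = 0.
  by rewrite -[LHS](MC_grE A x) A0 fsfunE.
have [m [km pA0]] := dl_in_eq0_seq (mxsupp A) coef0.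
(* [A] is replaced by its image at stage [m], which has the same class and whose coefficients all
   vanish: those in [mxsupp A] by the choice of [m], the others because they were already 0. *)
rewrite -[LHS](dl_in_push (D := MC_sys n (groupring R G)) km).
rewrite (_ : push _ _ = 0) ?rmorph0 //.
apply: mxcoef_inj => x; rewrite mxcoef_push.
have -> : mxcoef x (0 : 'M[groupring R G]_(n ^ m)) = 0.
  by apply/matrixP=> i j; rewrite !mxE fsfunE.
have [/pA0 //|/mxcoef_dflt->] := boolP (x \in mxsupp A).
exact: (rmorph0 (push (D := MC_sys n R) km)).
Qed.

Lemma MC_gr_surj b : exists a, MC_gr a = b.
Proof.
rewrite (gr_sum_single b); elim/big_ind: _ => [|_ _ [u <-] [v <-]|x _].
- by exists 0; rewrite rmorph0.
- by exists (u + v); rewrite rmorphD.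
have [k [A ->]] := MC_inP (b x).
(* With [A] representing the coefficient of [b] at [x], the preimage of that single term is the
   class of the matrix with entries [A i j] times [x]. *)
exists (MC_in n _ k (map_mx (gr_single x) A)); apply/fsfunP=> y.
rewrite MC_grE gr_singleE; case: eqP => [->|/eqP yx].
  congr (MC_in n R k _).
  by apply/matrixP=> i j; rewrite !mxE gr_singleE eqxx.
rewrite (_ : mxcoef _ _ = 0) ?rmorph0 //.
by apply/matrixP=> i j; rewrite !mxE gr_singleE (negPf yx).
Qed.
End Ring.

Lemma MC_gr_natural (R S : pzRingType) (f : {rmorphism R -> S}) u :
  MC_gr S (MC_map n (gr_map f) u) = gr_map (MC_map n f) (MC_gr R u).
Proof.
have [k [A ->]] := MC_inP u; apply/fsfunP=> x.
rewrite MC_mapE gr_mapE !MC_grE MC_mapE; congr (MC_in n S k _).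
by apply/matrixP=> i j; rewrite !mxE gr_mapE.
Qed.

End Comparison.

Theorem proposition9 (n : nat) (n_gt0 : (0 < n)%N) (G : groupType) :
  exists theta : natTrans
      (comp_functor (groupring_functor G) (MC_functor n))
      (comp_functor (MC_functor n) (groupring_functor G)),
    natIso theta.
Proof.
pose inv R := bij_ring_iso (@MC_gr_inj n G R) (@MC_gr_surj n G R).
pose theta R := sval (inv R).
have MC_grK R : cancel (MC_gr n G R) (theta R) := (svalP (inv R)).1.
have thetaK R : cancel (theta R) (MC_gr n G R) := (svalP (inv R)).2.
have theta_natural (R S : pzRingType) (f : {rmorphism R -> S}) :
    theta S \o gr_map (MC_map n f) =1 MC_map n (gr_map f) \o theta R.
  (* Naturality passes to the inverse: write [a] as the image under [MC_gr] of [theta R a], use the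
     naturality of [MC_gr], and cancel. *)
  move=> a /=; rewrite -[X in gr_map _ X]thetaK -MC_gr_natural.
  exact: MC_grK.
exists (@NatTrans (comp_functor (groupring_functor G) (MC_functor n))
  (comp_functor (MC_functor n) (groupring_functor G)) theta theta_natural).
by move=> R; exists (MC_gr n G R); split; [apply: thetaK | apply: MC_grK].
Qed.
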